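(* Let $n\in\mathbb{N}$, let $\tau\in\mathcal{R}$, and let the numbers $0=t_1<\dots<t_n$ be such that $\tau+t_n\le1$ almost everywhere. Set $\tau_k:=\tau+t_k$, $k=1,\dots,n$, and $t^*:=\left\|\tau-\frac{1-t_n}2\right\|_\infty$. Then $$E(\tau_1,\dots,\tau_n)=2\sum_{k=1}^{n-1}I\left(\frac{t_{k+1}-t_k}2\right)+I\left(\frac{1-t_n}2-t^*\right)+I\left(\frac{1-t_n}2+t^*\right).$$ Moreover, the method of recovery $S=\sum_{k=1}^nc_k^*\xi_{\tau_k}$ is optimal, i.e. $e(\tau_1,\dots,\tau_n;S)=E(\tau_1,\dots,\tau_n)$, where, for $n\ge2$, $c_1^*=\tau+\frac{t_2-t_1}2$, $c_k^*=\frac{t_{k+1}-t_{k-1}}2$ for $k=2,\dots,n-1$, and $c_n^*=1-\tau-\frac{t_n+t_{n-1}}2$; and, for $n=1$, $c_1^*=1$.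
   Context: $(\Omega,\mathcal{F},P)$ is a fixed probability space and $\mathbb{E}$ denotes expectation. For a random variable $\eta$ on it, $\|\eta\|_\infty:=\operatorname{ess\,sup}_{w\in\Omega}|\eta(w)|$. $\mathcal{R}$ is the set of all random variables $\eta$ on $(\Omega,\mathcal{F},P)$ with $\eta(w)\in[0,1]$ for all $w\in\Omega$; a random variable with values in $[0,1]$ only almost everywhere is regarded as an element of $\mathcal{R}$ after modification on a null set. $\omega$ is a fixed concave modulus of continuity: a continuous non-decreasing concave function $\omega\colon[0,\infty)\to[0,\infty)$ with $\omega(0)=0$. For $t\ge0$, $I(t):=\int_0^t\omega(s)\,ds$. $\mathcal{H}^\omega$ is the class of all (jointly) measurable real-valued random processes $\xi_t$, $t\in[0,1]$, on $(\Omega,\mathcal{F},P)$ such that $\mathbb{E}|\xi_\tau-\xi_\theta|\le\omega(\|\tau-\theta\|_\infty)$ for all $\tau,\theta\in\mathcal{R}$, where $\xi_\tau$ is the random variable $w\mapsto\xi_{\tau(w)}(w)$. Given $\tau_1,\dots,\tau_n\in\mathcal{R}$, a method of recovery (of $\int_0^1\xi_t\,dt$ for $\xi\in\mathcal{H}^\omega$) is $S=S^\varphi_n(\xi;\tau_1,\dots,\tau_n)=\varphi(\xi_{\tau_1},\dots,\xi_{\tau_n})$, where $\varphi$ is an arbitrary mapping from $n$-tuples of real-valued random variables on $(\Omega,\mathcal{F},P)$ to real-valued random variables on $(\Omega,\mathcal{F},P)$. Its error is $$e(\tau_1,\dots,\tau_n;S):=\sup_{\xi\in\mathcal{H}^\omega}\mathbb{E}\left|\int_0^1\xi_t\,dt-S^\varphi_n(\xi;\tau_1,\dots,\tau_n)\right|,$$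 and $E(\tau_1,\dots,\tau_n):=\inf_Se(\tau_1,\dots,\tau_n;S)$, the infimum being over all methods of recovery. *)

(* Defs.v *)
From HB Require Import structures.
From mathcomp Require Import all_boot all_order all_algebra.
From mathcomp Require Import all_classical all_reals all_analysis.
From mathcomp Require Import measurable_realfun ess_sup_inf.

Set Implicit Arguments.
Unset Strict Implicit.
Unset Printing Implicit Defensive.

Import Order.TTheory GRing.Theory Num.Theory.
Import numFieldNormedType.Exports.

Local Open Scope classical_set_scope.
Local Open Scope ring_scope.

(* A function on [0, +oo[ is represented by a function on R of which only the
   values at nonnegative arguments matter. *)
Record concave_modulus (R : realType) (omega : R -> R) : Prop := {
  modulus_ge0 : forall s, 0 <= s -> 0 <= omega s ;
  modulus0 : omega 0 = 0 ;
  modulus_continuous : {within `[0, +oo[, continuous omega} ;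
  modulus_nondecreasing :
    forall s t, 0 <= s -> s <= t -> omega s <= omega t ;
  modulus_concave :
    forall s t l, 0 <= s -> 0 <= t -> 0 <= l -> l <= 1 ->
      l * omega s + (1 - l) * omega t <= omega (l * s + (1 - l) * t) }.

Definition modulus_primitive (R : realType) (omega : R -> R) (t : R) : R :=
  \int[@lebesgue_measure R]_(s in `[0, t]) omega s.

Section Recovery.
Context d (T : measurableType d) (R : realType) (P : probability T R).

(* The essential supremum is taken in \bar R; [fine] is harmless here since it
   is only applied to almost surely bounded functions. *)
Definition norm_infty (eta : T -> R) : R :=
  fine (ess_sup P (fun w => `|eta w|%:E)).

Record random_time := RandomTime {
  random_time_val :> {mfun T >-> R} ;
  random_timeP : forall w, 0 <= random_time_val w <= 1 }.

(* A process indexed by [0, 1]: its values at times outside [0, 1] are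
   irrelevant, and joint measurability is only required on [0, 1] x T. *)
Record process := Process {
  process_val :> R -> T -> R ;
  processP : measurable_fun ((`[0, 1]%classic : set R) `*` [set: T])
               (fun p : R * T => process_val p.1 p.2) }.

Definition sample_fun (xi : process) (tau : random_time) (w : T) : R :=
  xi (tau w) w.

Lemma measurable_sample_fun (xi : process) (tau : random_time) :
  measurable_fun [set: T] (sample_fun xi tau).
Proof.
rewrite (_ : sample_fun xi tau =
  (fun p : R * T => xi p.1 p.2) \o (fun w => (tau w, w))); last by [].
apply: (measurable_comp _ _ (processP xi)).
- by apply: measurableX => //; exact: measurable_itv.
- move=> _ [w _ <-] /=; split=> //=.
  by rewrite in_itv /=; exact: random_timeP.
- exact: measurable_fun_pair.
Qed.

HB.instance Definition _ (xi : process) (tau : random_time) :=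
  isMeasurableFun.Build _ _ _ _ (sample_fun xi tau)
    (measurable_sample_fun xi tau).

Definition sample (xi : process) (tau : random_time) : {mfun T >-> R} :=
  sample_fun xi tau.

Definition modulus_class (omega : R -> R) : set process :=
  [set xi | forall tau theta : random_time,
     ('E_P[fun w => `|sample xi tau w - sample xi theta w|%R]
       <= (omega (norm_infty (fun w => tau w - theta w)%R))%:E)%E].

(* For xi in modulus_class omega the path t |-> xi t w is integrable on [0, 1]
   for almost every w, so the default value taken by the real-valued integral
   at non-integrable paths does not affect expectations. *)
Definition path_integral (xi : process) (w : T) : R :=
  \int[@lebesgue_measure R]_(t in `[0, 1]) xi t w.

Definition recovery_method (n : nat) : Type :=
  n.-tuple {mfun T >-> R} -> {mfun T >-> R}.

Definition recovery_value (n : nat) (tau : 'I_n -> random_time)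
    (phi : recovery_method n) (xi : process) : {mfun T >-> R} :=
  phi [tuple sample xi (tau k) | k < n].

Definition recovery_error (omega : R -> R) (n : nat)
    (tau : 'I_n -> random_time) (phi : recovery_method n) : \bar R :=
  ereal_sup
    [set ('E_P[fun w => `|path_integral xi w - recovery_value tau phi xi w|%R])%E
      | xi in modulus_class omega].

Definition optimal_error (omega : R -> R) (n : nat)
    (tau : 'I_n -> random_time) : \bar R :=
  ereal_inf [set recovery_error omega tau phi | phi in [set: recovery_method n]].

Definition linear_method (n : nat) (c : 'I_n -> {mfun T >-> R}) :
    recovery_method n :=
  fun x => \sum_(k < n) c k * tnth x k.

(* The indices run from 1 to n. *)
Definition optimal_coef (n : nat) (t : nat -> R) (tau : random_time)
    (k : nat) : {mfun T >-> R} :=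
  if n == 1%N then 1
  else if k == 1%N then
    (tau : {mfun T >-> R}) + cst ((t 2%N - t 1%N) / 2)
  else if k == n then
    1 - (tau : {mfun T >-> R}) - cst ((t n + t n.-1) / 2)
  else cst ((t k.+1 - t k.-1) / 2).

End Recovery.

(* Main.v *)
(** Upper bound. Cut [0, 1] into cells at the midpoints between consecutive
    nodes tau + t_k. Translating or reflecting each half-cell to start at its
    node turns the error into integrals over r of E|xi_theta - xi_eta| for
    random times at distance r, each at most omega(r). The half-cells between
    nodes have deterministic lengths and give I((t_{k+1} - t_k)/2) each. The two
    end cells have random lengths tau and 1 - t_n - tau, both at least
    a = (1 - t_n)/2 - t*: the first a units of each give I(a), and what is left
    of the two, of total length 2 t*, is glued into a single family of random
    times indexed by r in [a, a + 2 t*].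

    Lower bound. The worst processes live on the event A where
    |tau - (1 - t_n)/2| > t* - e: there xi_t = +- omega(dist(t, nodes)) / P(A).
    Only the sup-norm of tau - theta enters the definition of the class, so
    concentrating the mass on A costs nothing; both signs have zero samples. *)
From HB Require Import structures.
Require Import Defs.
From mathcomp Require Import all_boot all_order all_algebra.
From mathcomp Require Import all_classical all_reals all_analysis.
From mathcomp Require Import measurable_realfun ess_sup_inf.
From mathcomp Require Import lra ring.

Import Order.TTheory GRing.Theory Num.Theory.
Import numFieldNormedType.Exports.

Local Open Scope classical_set_scope.
Local Open Scope ring_scope.

(** * Integrals over intervals *)

Section lebesgue_integral_itv.
Set Implicit Arguments.
Unset Strict Implicit.
Context (R : realType).
Local Notation mu := (@lebesgue_measure R).

Lemma ge0_integral_itvU (a b c : R) (f : R -> \bar R) : a <= b -> b <= c ->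
  measurable_fun `[a, c] f -> (forall s, s \in `[a, c] -> (0 <= f s)%E) ->
  (\int[mu]_(s in `[a, c]) f s =
   \int[mu]_(s in `[a, b]) f s + \int[mu]_(s in `[b, c]) f s)%E.
Proof.
move=> ab bc mf f0.
rewrite (@itv_bndbnd_setU _ _ _ (BRight b)) ?bnd_simp//.
have acE : `[a, c]%classic = `[a, b] `|` `]b, c].
  by rewrite -itv_bndbnd_setU ?bnd_simp.
rewrite ge0_integral_setU// -?acE//.
- rewrite integral_itv_obnd_cbnd//; apply: measurable_funS mf => //.
  by apply: subset_itv; rewrite bnd_simp.
- apply/disj_setPS => s [/=]; rewrite !in_itv/= => /andP[_ sb] /andP[].
  by rewrite ltNge sb.
Qed.

(** Translation invariance follows from uniqueness of the measure that gives half-open intervals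
    their length. *)
Lemma lebesgue_measureD (c : R) (A : set R) : measurable A ->
  pushforward mu (+%R c : _ -> measurableTypeR R) A = mu A.
Proof.
have mc : measurable_fun [set: R] (+%R c) by exact: measurable_funD.
pose mphi := isMeasurableFun.Build _ _
  (measurableTypeR R) (measurableTypeR R) (+%R c) mc.
(* Bundling the translation makes its pushforward a measure, as the uniqueness result requires. *)
pose phi : {mfun measurableTypeR R >-> measurableTypeR R} :=
  HB.pack (+%R c : measurableTypeR R -> measurableTypeR R) mphi.
move=> mA; apply/esym.
apply: (@lebesgue_measure_unique _ (pushforward mu phi)) => //= _ [[a b]] _ <-.
rewrite /pushforward.
have -> : +%R c @^-1` `]a, b] = `](a - c), (b - c)]%classic.
  apply/seteqP; split=> r /=; rewrite !in_itv/=; lra.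
rewrite !lebesgue_measure_itv/= !lte_fin ltrD2r.
by case: ifP => // _; rewrite -!EFinB; congr _%:E; ring.
Qed.

Lemma ge0_integral_itvD (f : R -> \bar R) (a b c : R) :
  measurable_fun setT f -> (forall s, (0 <= f s)%E) ->
  (\int[mu]_(s in `[(c + a)%R, (c + b)%R]) f s =
   \int[mu]_(s in `[a, b]) f (c + s)%R)%E.
Proof.
move=> mf f0.
rewrite (_ : `[a, b]%classic =
    (+%R c : _ -> measurableTypeR R) @^-1` `[(c + a)%R, (c + b)%R]); last first.
  by apply/seteqP; split=> r /=; rewrite !in_itv/= !lerD2l.
have mc : measurable_fun [set: measurableTypeR R]
    (+%R c : _ -> measurableTypeR R) by exact: measurable_funD.
rewrite -ge0_integral_pushforward//=; last exact: measurable_funS mf.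
apply: eq_measure_integral => A mA _.
exact/esym/lebesgue_measureD.
Qed.

Lemma ge0_integral_itvN (f : R -> \bar R) (a b : R) :
  measurable_fun setT f -> (forall s, (0 <= f s)%E) ->
  (\int[mu]_(s in `[(- b)%R, (- a)%R]) f s =
   \int[mu]_(s in `[a, b]) f (- s)%R)%E.
Proof.
move=> mf f0.
rewrite (_ : `[a, b]%classic =
    (-%R : _ -> measurableTypeR R) @^-1` `[(- b)%R, (- a)%R]); last first.
  by rewrite opp_preimage_itvbndbnd /= !opprK.
rewrite -ge0_integral_pushforward//=; last exact: measurable_funS mf.
by apply: eq_measure_integral => //= A mA AS; exact/esym/lebesgue_measureN.
Qed.

Lemma ge0_integral_itvB (f : R -> \bar R) (a b c : R) :
  measurable_fun setT f -> (forall s, (0 <= f s)%E) ->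
  (\int[mu]_(s in `[(c - b)%R, (c - a)%R]) f s =
   \int[mu]_(s in `[a, b]) f (c - s)%R)%E.
Proof.
move=> mf f0; rewrite ge0_integral_itvD//.
rewrite -(@ge0_integral_itvN (fun s => f (c + s)))//.
by apply: measurableT_comp => //; exact: measurable_funD.
Qed.

End lebesgue_integral_itv.

(** * Concave moduli and their primitives *)

Section concave_modulus_theory.
Set Implicit Arguments.
Unset Strict Implicit.
Context (R : realType) (omega : R -> R).
Hypothesis homega : concave_modulus omega.
Local Notation mu := (@lebesgue_measure R).
Local Notation I := (modulus_primitive omega).

(** Concavity on the segment from 0 to [x + y], with [omega 0 = 0], bounds [omega z] below by its
    share [z / (x + y)] of [omega (x + y)]; the shares of [x] and [y] add up to 1. *)
Lemma modulus_subadditive x y :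
  0 <= x -> 0 <= y -> omega (x + y) <= omega x + omega y.
Proof.
move=> x0 y0; have [->|x_neq0] := eqVneq x 0.
  by rewrite add0r lerDr modulus_ge0.
have xy0 : 0 < x + y by rewrite ltr_pwDl// lt_neqAle eq_sym x_neq0.
have scale z : 0 <= z -> z <= x + y -> z / (x + y) * omega (x + y) <= omega z.
  move=> z0 zxy; have := modulus_concave homega (ltW xy0) (lexx 0)
    (divr_ge0 z0 (ltW xy0)).
  rewrite ler_pdivrMr// mul1r modulus0// !mulr0 !addr0 divfK ?gt_eqF//.
  exact.
have -> : omega (x + y) =
    x / (x + y) * omega (x + y) + y / (x + y) * omega (x + y).
  by rewrite -mulrDl -mulrDl divff ?mul1r// gt_eqF.
by rewrite lerD// scale// ?lerDl ?lerDr.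
Qed.

(** Subadditivity makes [omega] its own modulus of continuity. Hence composing [omega] with a
    1-Lipschitz function again gives increments bounded by [omega]. *)
Lemma modulus_distB x y :
  0 <= x -> 0 <= y -> `|omega x - omega y| <= omega `|x - y|.
Proof.
wlog xy : x y / x <= y.
  by move=> h x0 y0; case: (leP x y) => [/h|/ltW/h]; [exact|];
    rewrite distrC [`|y - x|]distrC; exact.
move=> x0 y0; rewrite distrC [`|x - y|]distrC !ger0_norm ?subr_ge0//.
  rewrite lerBlDl (le_trans _ (modulus_subadditive _ _))// ?subr_ge0//.
  by rewrite subrKC.
exact: modulus_nondecreasing.
Qed.

Lemma measurable_modulus : measurable_fun (`[0, +oo[%classic : set R) omega.
Proof.
by apply: subspace_continuous_measurable_fun => //; exact: modulus_continuous.
Qed.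

(** The truncation gives a total measurable function that agrees with [omega] at nonnegative
    arguments. *)
Lemma measurable_modulus_max0 :
  measurable_fun setT (fun s : R => omega (Num.max 0 s)).
Proof.
apply: (measurable_comp _ _ measurable_modulus) => //.
  by move=> _ [s _ <-] /=; rewrite in_itv/= andbT le_max lexx.
exact: measurable_maxr.
Qed.

Lemma measurable_modulusS (D : set R) : D `<=` `[0, +oo[ ->
  measurable_fun D (EFin \o omega).
Proof.
move=> D0; apply/measurable_EFinP.
by apply: measurable_funS measurable_modulus.
Qed.

Lemma integrable_modulus t : mu.-integrable `[0, t] (EFin \o omega).
Proof.
apply: continuous_compact_integrable; first exact: segment_compact.
apply: continuous_subspaceW (modulus_continuous homega).
by apply: subset_itvl; rewrite bnd_simp.
Qed.

Lemma modulus_primitiveE t :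
  (I t)%:E = (\int[mu]_(s in `[0%R, t]) (omega s)%:E)%E.
Proof.
by rewrite /modulus_primitive /Rintegral fineK// integrable_fin_num//;
  exact: integrable_modulus.
Qed.

Lemma modulus_primitiveB x y : 0 <= x -> x <= y ->
  (I y)%:E = ((I x)%:E + \int[mu]_(s in `[x, y]) (omega s)%:E)%E.
Proof.
move=> x0 xy; rewrite !modulus_primitiveE (ge0_integral_itvU x0)//.
- by apply: measurable_modulusS; apply: subset_itvl; rewrite bnd_simp.
- by move=> s; rewrite in_itv/= => /andP[s0 _]; rewrite lee_fin modulus_ge0.
Qed.

Lemma le_modulus_primitive x y : 0 <= x -> x <= y -> I x <= I y.
Proof.
move=> x0 xy; rewrite -lee_fin (modulus_primitiveB x0 xy)// leeDl//.
apply: integral_ge0 => s /=; rewrite in_itv/= => /andP[xs _].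
by rewrite lee_fin modulus_ge0// (le_trans x0).
Qed.

(** Monotonicity bounds the integrand by [omega y]. This measures the loss in the lower bound when
    [tau] only comes close to its extreme values. *)
Lemma modulus_primitive_le x y : 0 <= x -> x <= y ->
  I y <= I x + (y - x) * omega y.
Proof.
move=> x0 xy; rewrite -lee_fin (modulus_primitiveB x0 xy)// EFinD leeD2lE//.
apply: (@le_trans _ _ (\int[mu]_(s in `[x, y]) (cst (omega y)%:E) s)%E).
  apply: ge0_le_integral => //=.
  - move=> s; rewrite in_itv/= => /andP[xs _].
    by rewrite lee_fin modulus_ge0// (le_trans x0).
  - by apply: measurable_modulusS; apply: subset_itv; rewrite bnd_simp.
  - move=> s; rewrite in_itv/= => /andP[xs sy].
    by rewrite lee_fin modulus_nondecreasing// (le_trans x0).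
rewrite integral_cst//= lebesgue_measure_itv/= lte_fin.
case: ltP => _; first by rewrite -EFinB -EFinM mulrC.
rewrite mule0 lee_fin mulr_ge0// ?subr_ge0// modulus_ge0//.
exact: le_trans x0 xy.
Qed.

End concave_modulus_theory.

(** * Nearest-node quadrature along a path *)

Section nearest_point_quadrature.
Set Implicit Arguments.
Unset Strict Implicit.
Context (R : realType).
Local Notation mu := (@lebesgue_measure R).
Variables (f : R -> R) (mf : measurable_fun setT f).

(* When [B] is infinite nothing is claimed, not even that [f] is integrable. *)
Definition quadrature_bound (a b V : R) (B : \bar R) : Prop :=
  [/\ a <= b, (0 <= B)%E &
    (B < +oo)%E -> mu.-integrable `[a, b] (EFin \o f) /\
      (`|\int[mu]_(t in `[a, b]) f t - V|%:E <= B)%E].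

Lemma integrable_cst_itv (a b c : R) :
  mu.-integrable `[a, b] (EFin \o cst c).
Proof.
apply/integrableP; split; first exact/measurable_EFinP/measurable_cst.
rewrite (_ : (fun _ => _) = cst `|c|%:E); last by apply/funext.
rewrite integral_cst//= lebesgue_measure_itv/=.
by case: ifP => _; rewrite ?mule0 ?ltry// -EFinB -EFinM ltry.
Qed.

Lemma fine_lebesgue_measure_itv (a b : R) : a <= b -> fine (mu `[a, b]) = b - a.
Proof.
move=> ab; rewrite lebesgue_measure_itv/= lte_fin.
by case: ltgtP ab => // -> _; rewrite subrr.
Qed.

(** A finite bound makes [f - c] integrable, hence also [f], since constants are integrable on a
    bounded interval. *)
Lemma quadrature_bound_cst a b c : a <= b ->
  quadrature_bound a b ((b - a) * c) (\int[mu]_(t in `[a, b]) `|f t - c|%:E)%E.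
Proof.
move=> ab; split => //; first by apply: integral_ge0 => t _; rewrite lee_fin.
move=> Boo.
have mfc : measurable_fun `[a, b] (fun t => f t - c).
  by apply: measurable_funB => //; exact: measurable_funS mf.
have ifc : mu.-integrable `[a, b] (EFin \o (fun t => f t - c)).
  by apply/integrableP; split=> //; exact/measurable_EFinP.
have If : mu.-integrable `[a, b] (EFin \o f).
  rewrite (_ : EFin \o f = (EFin \o (fun t => f t - c)%R) \+ (EFin \o cst c))%E.
    by apply: integrableD => //; exact: integrable_cst_itv.
  by apply/funext => t /=; rewrite -EFinD subrK.
split=> //.
have -> : \int[mu]_(t in `[a, b]) f t - (b - a) * c =
    \int[mu]_(t in `[a, b]) (f t - c).
  have /= -> := RintegralB _ If (integrable_cst_itv a b c); last by [].
  by rewrite Rintegral_cst// fine_lebesgue_measure_itv// mulrC.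
rewrite (le_trans (y := (\int[mu]_(t in `[a, b]) `|f t - c|)%:E))//.
  by rewrite lee_fin le_normr_Rintegral.
by rewrite /Rintegral fineK// ge0_fin_numE// integral_ge0.
Qed.

(** Nonnegativity of both bounds lets finiteness of [B + C] pass to each of them; the rest is
    additivity and the triangle inequality. *)
Lemma quadrature_bound_cat a b c V W B C :
  quadrature_bound a b V B -> quadrature_bound b c W C ->
  quadrature_bound a c (V + W) (B + C)%E.
Proof.
move=> [ab B0 QB] [bc C0 QC]; split; [exact: le_trans bc|exact: adde_ge0|].
move=> BCoo.
have [iB VB] := QB (le_lt_trans (leeDl _ C0) BCoo).
have [iC WC] := QC (le_lt_trans (leeDr _ B0) BCoo).
have iac : mu.-integrable `[a, c] (EFin \o f).
  apply/integrableP; split.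
    by apply/measurable_EFinP; exact: measurable_funS mf.
  rewrite (ge0_integral_itvU ab bc)//.
    by apply: lte_add_pinfty; [case/integrableP: iB|case/integrableP: iC].
  apply/measurable_EFinP; apply: measurableT_comp => //.
  exact: measurable_funS mf.
split=> //.
have split_ac : \int[mu]_(t in `[a, c]) f t =
    \int[mu]_(t in `[a, b]) f t + \int[mu]_(t in `[b, c]) f t.
  rewrite -(@Rintegral_itv_obnd_cbnd _ b (BRight c)).
    by rewrite -(Rintegral_itvB iac) ?bnd_simp// addrC subrK.
  by apply: integrableS iC => //; apply: subset_itvr; rewrite bnd_simp.
rewrite split_ac (le_trans (y := (`|\int[mu]_(t in `[a, b]) f t - V|%:E +
  `|\int[mu]_(t in `[b, c]) f t - W|%:E)%E))// ?leeD//.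
by rewrite -EFinD lee_fin (le_trans _ (ler_normD _ _))// opprD addrACA.
Qed.

Definition right_deviation (x l : R) : \bar R :=
  (\int[mu]_(r in `[0%R, l]) `|f (x + r) - f x|%:E)%E.
Definition left_deviation (x l : R) : \bar R :=
  (\int[mu]_(r in `[0%R, l]) `|f (x - r) - f x|%:E)%E.

Lemma measurable_dist c : measurable_fun setT (fun t => `|f t - c|%:E).
Proof.
apply/measurable_EFinP; apply: measurableT_comp => //.
exact: measurable_funB.
Qed.

Lemma quadrature_bound_right x l : 0 <= l ->
  quadrature_bound x (x + l) (l * f x) (right_deviation x l).
Proof.
move=> l0; have /quadrature_bound_cst : x <= x + l by rewrite lerDl.
move=> /(_ (f x)); have -> : x + l - x = l by rewrite addrC addKr.
rewrite -[X in `[X, _]](addr0 x) ge0_integral_itvD//; exact: measurable_dist.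
Qed.

Lemma quadrature_bound_left x l : 0 <= l ->
  quadrature_bound (x - l) x (l * f x) (left_deviation x l).
Proof.
move=> l0; have /quadrature_bound_cst : x - l <= x by rewrite gerBl.
move=> /(_ (f x)); rewrite subKr.
rewrite -[X in `[_, X]](subr0 x) ge0_integral_itvB//; exact: measurable_dist.
Qed.

Variables (n : nat) (x : nat -> R).
Hypothesis x_nondecreasing : forall k, (1 <= k < n)%N -> x k <= x k.+1.
Let h k := (x k.+1 - x k) / 2.

(** Each gap is cut at its midpoint, and each half is integrated by the value at its own node. *)
Lemma quadrature_bound_nodes m : (1 <= m <= n)%N ->
  quadrature_bound (x 1%N) (x m)
    (\sum_(1 <= k < m) h k * (f (x k) + f (x k.+1)))
    (\sum_(1 <= k < m)
       (right_deviation (x k) (h k) + left_deviation (x k.+1) (h k)))%E.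
Proof.
elim: m => [//|[_ _|m IHm /andP[_ mn]]].
  rewrite !big_geq//.
  (* The single point [x 1] is treated as a right half-cell of length 0. *)
  have := quadrature_bound_right (x 1%N) (lexx 0).
  by rewrite addr0 mul0r /right_deviation set_itv1 integral_set1.
rewrite !(big_nat_recr m.+1)//=; apply: quadrature_bound_cat.
  by apply: IHm; exact: ltnW.
rewrite mulrDr.
have h0 : 0 <= h m.+1 by rewrite divr_ge0// subr_ge0 x_nondecreasing.
have mid : x m.+1 + h m.+1 = x m.+2 - h m.+1 by rewrite /h; field.
apply: quadrature_bound_cat; first exact: quadrature_bound_right.
by rewrite mid; exact: quadrature_bound_left.
Qed.

Lemma nearest_point_quadrature_bound : (0 < n)%N -> 0 <= x 1%N -> x n <= 1 ->
  (`|\int[mu]_(t in `[0, 1]) f t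
     - (x 1%N * f (x 1%N) + \sum_(1 <= k < n) h k * (f (x k) + f (x k.+1))
        + (1 - x n) * f (x n))|%:E
   <= left_deviation (x 1%N) (x 1%N) +
      \sum_(1 <= k < n)
        (right_deviation (x k) (h k) + left_deviation (x k.+1) (h k))
      + right_deviation (x n) (1 - x n))%E.
Proof.
move=> n0 x1 xn.
have Q0 := quadrature_bound_left (x 1%N) x1; rewrite subrr in Q0.
have Qm := quadrature_bound_nodes (m := n); rewrite n0 leqnn in Qm.
have xn' : 0 <= 1 - x n by rewrite subr_ge0.
have Qn := quadrature_bound_right (x n) xn'; rewrite subrKC in Qn.
have [_ _] := quadrature_bound_cat (quadrature_bound_cat Q0 (Qm isT)) Qn.
(* With an infinite bound the inequality is trivial, whatever default value the path integral
   takes. *)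
set B := (X in (X < +oo)%E -> _); have [_ /(_ isT)[]//|] := ltP B +oo%E.
by move=> Boo _; apply: le_trans Boo; exact: leey.
Qed.

End nearest_point_quadrature.

(** * Random times and expected deviations *)

Section essential_norm.
Set Implicit Arguments.
Unset Strict Implicit.
Context d (T : measurableType d) (R : realType) (P : probability T R).
Implicit Types eta : T -> R.

Lemma ess_sup_norm_bounds eta M : (forall w, `|eta w| <= M) ->
  (0 <= ess_sup P (fun w => `|eta w|%:E) <= M%:E)%E.
Proof.
move=> etaM; apply/andP; split.
  have PT : (0 < P [set: T])%E by rewrite probability_setT lte_fin ltr01.
  apply: ess_sup_gee; first exact: PT.
  by apply: nearW => w; rewrite lee_fin.
by apply/ess_supP; apply: nearW => w; rewrite lee_fin.
Qed.

(** The pointwise bound [M] keeps the essential supremum finite, so [fine] loses nothing. *)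
Lemma EFin_norm_infty eta M : (forall w, `|eta w| <= M) ->
  (norm_infty P eta)%:E = ess_sup P (fun w => `|eta w|%:E).
Proof.
move=> /ess_sup_norm_bounds /andP[s0 sM]; rewrite /norm_infty fineK//.
by rewrite ge0_fin_numE// (le_lt_trans sM)// ltry.
Qed.

Lemma ae_le_norm_infty eta M : (forall w, `|eta w| <= M) ->
  {ae P, forall w, `|eta w| <= norm_infty P eta}.
Proof.
move=> etaM; have := ess_sup_ge P (fun w => `|eta w|%:E).
by rewrite -(EFin_norm_infty etaM); apply: filterS => w; rewrite lee_fin.
Qed.

Lemma norm_infty_ge0 eta M : (forall w, `|eta w| <= M) ->
  0 <= norm_infty P eta.
Proof.
move=> etaM; rewrite -lee_fin (EFin_norm_infty etaM).
by have /andP[] := ess_sup_norm_bounds etaM.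
Qed.

Lemma norm_infty_le eta M b : (forall w, `|eta w| <= M) ->
  {ae P, forall w, `|eta w| <= b} -> norm_infty P eta <= b.
Proof.
move=> etaM etab; rewrite -lee_fin (EFin_norm_infty etaM); apply/ess_supP.
by apply: filterS etab => w; rewrite lee_fin.
Qed.

Lemma measurable_norm_gt eta c : measurable_fun setT eta ->
  measurable [set w | (c < `|eta w|)%R].
Proof.
move=> meta; have /(_ measurableT [set true]) := measurable_fun_ltr
  (measurable_cst c) (measurableT_comp (@normr_measurable R setT) meta).
by rewrite setTI; exact.
Qed.

(** If this event were null, the norm minus [e] would be an almost sure bound. The event carries the
    extremal processes of the lower bound. *)
Lemma norm_infty_attained eta M e : measurable_fun setT eta ->
  (forall w, `|eta w| <= M) -> 0 < e ->
  (0 < P [set w | (norm_infty P eta - e < `|eta w|)%R])%E.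
Proof.
move=> meta etaM e0; rewrite lt0e measure_ge0 andbT; apply/eqP => P0.
suff : norm_infty P eta <= norm_infty P eta - e.
  by rewrite leNgt ltrBlDr ltrDl e0.
apply: (norm_infty_le etaM).
exists [set w | (norm_infty P eta - e < `|eta w|)%R]; split => [|//|w /=].
  exact: measurable_norm_gt.
by rewrite ltNge => /negP.
Qed.

End essential_norm.

Section clamping.
Set Implicit Arguments.
Unset Strict Implicit.
Context (R : realType).

(** Retraction of the line onto [0, 1]. It turns any measurable function into a random time and
    never increases distances between times. *)
Definition clamp (t : R) : R := Num.max 0 (Num.min t 1).

Lemma clamp_itv t : 0 <= clamp t <= 1.
Proof. by rewrite /clamp le_max lexx ge_max ler01 ge_min lexx orbT. Qed.

Lemma clampE t : 0 <= t <= 1 -> clamp t = t.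
Proof. by move=> /andP[t0 t1]; rewrite /clamp (min_idPl t1) (max_idPr t0). Qed.

Lemma clamp_dist s t : `|clamp s - clamp t| <= `|s - t|.
Proof.
wlog ts : s t / t <= s.
  move=> h; case: (leP t s) => [/h//|/ltW/h].
  by rewrite distrC [`|t - s|]distrC.
have -> : `|s - t| = s - t by rewrite ger0_norm ?subr_ge0.
have [ts' le_sub] : clamp t <= clamp s /\ clamp s - clamp t <= s - t.
  rewrite /clamp; case: (leP s 1) => ?; case: (leP t 1) => ?; rewrite !maxEle;
  by split; repeat (case: ifPn; rewrite -?ltNge => ?); lra.
by rewrite ger0_norm ?subr_ge0.
Qed.

Lemma measurable_clamp : measurable_fun setT clamp.
Proof. by apply: measurable_maxr => //; exact: measurable_minr. Qed.

End clamping.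

Section expected_deviation.
Set Implicit Arguments.
Unset Strict Implicit.
Context d (T : measurableType d) (R : realType) (P : probability T R).
Local Notation mu := (@lebesgue_measure R).

Lemma measurable_clamp_comp (g : T -> R) : measurable_fun setT g ->
  measurable_fun setT (fun w => clamp (g w)).
Proof. by move=> mg; apply: measurableT_comp mg; exact: measurable_clamp. Qed.

Definition clamp_mfun (g : T -> R) (mg : measurable_fun setT g) :
    {mfun T >-> R} :=
  HB.pack (fun w => clamp (g w))
    (isMeasurableFun.Build _ _ _ _ _ (measurable_clamp_comp mg)).

Definition clamp_time (g : T -> R) (mg : measurable_fun setT g) :=
  @RandomTime _ T R (clamp_mfun mg) (fun w => clamp_itv (g w)).

(* A process is only assumed to be measurable on [0, 1] x T; this extension is
   measurable on R x T. *)
Definition clamped (xi : process T R) (t : R) (w : T) : R := xi (clamp t) w.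

Lemma measurable_clamped (xi : process T R) :
  measurable_fun setT (fun p : R * T => clamped xi p.1 p.2).
Proof.
rewrite (_ : (fun _ => _) =
  (fun p : R * T => xi p.1 p.2) \o (fun p => (clamp p.1, p.2))); last by [].
apply: (measurable_comp _ _ (processP xi)) => /=.
- by apply: measurableX => //; exact: measurable_itv.
- by move=> _ [p _ <-] /=; split=> //=; rewrite in_itv /= clamp_itv.
- apply: measurable_fun_pair => //.
  by apply: measurableT_comp => //; exact: measurable_clamp.
Qed.

Lemma measurable_clamped_comp (xi : process T R) (theta : R * T -> R) :
  measurable_fun setT theta ->
  measurable_fun setT (fun p : R * T => clamped xi (theta p) p.2).
Proof.
move=> mtheta; apply: (measurableT_comp (measurable_clamped xi)
  (g := fun p : R * T => (theta p, p.2))).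
exact: measurable_fun_pair.
Qed.

Variables (F : R * T -> \bar R) (a b : R).
Hypothesis mF : measurable_fun setT F.
Hypothesis F0 : forall p, (0 <= F p)%E.

(** Extension by zero outside the strip, so that Tonelli applies on the whole product. *)
Let G : measurableTypeR R * T -> \bar R := F \_ (`[a, b] `*` setT).

Let mG : measurable_fun setT G.
Proof.
have mD :
    measurable (`[a, b]%classic `*` [set: T] : set (measurableTypeR R * T)).
  exact: measurableX.
by apply/(measurable_restrictT F mD); exact: measurable_funS mF.
Qed.

Let G0 p : (0 <= G p)%E.
Proof. by rewrite /G patchE; case: ifP. Qed.

Let GE w : (fun r => G (r, w)) = (fun r => F (r, w)) \_ `[a, b].
Proof.
apply/funext => r; rewrite /G !patchE; congr (if _ then _ else _).
by apply/idP/idP => /set_mem; [case=> rab _|move=> rab]; exact/mem_set.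
Qed.

Lemma measurable_integral_itv :
  measurable_fun setT (fun w => \int[mu]_(r in `[a, b]) F (r, w))%E.
Proof.
rewrite (_ : (fun _ => _) = fubini_G mu G).
  exact: measurable_fun_fubini_tonelli_G.
by apply/funext => w; rewrite integral_mkcond -GE.
Qed.

Lemma fubini_tonelli_itv :
  (\int[P]_w \int[mu]_(r in `[a, b]) F (r, w) =
   \int[mu]_(r in `[a, b]) \int[P]_w F (r, w))%E.
Proof.
rewrite [RHS]integral_mkcond.
transitivity (\int[P]_w \int[mu]_r G (r, w))%E.
  by apply: eq_integral => w _; rewrite integral_mkcond -GE.
rewrite -(fubini_tonelli G)//; apply: eq_integral => r _.
rewrite patchE; case: ifPn => rab.
  apply: eq_integral => w _.
  by rewrite (congr1 (fun f => f r) (GE w)) patchE rab.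
rewrite [LHS]integral0_eq// => w _.
by rewrite (congr1 (fun f => f r) (GE w)) patchE (negbTE rab).
Qed.

End expected_deviation.

(** * Expected deviations along families of random times *)

Section expected_error.
Set Implicit Arguments.
Unset Strict Implicit.
Context d (T : measurableType d) (R : realType) (P : probability T R).
Local Notation mu := (@lebesgue_measure R).

Lemma measurable_path_integral (xi : process T R) :
  measurable_fun setT (path_integral xi).
Proof.
pose F (p : R * T) := (clamped xi p.1 p.2)%:E.
have mF : measurable_fun setT F.
  by apply/measurable_EFinP; exact: measurable_clamped.
(* Positive and negative parts are integrated separately, since Tonelli measurability concerns
   nonnegative integrands; [fine] is measurable, so infinite values do no harm. *)
have -> : path_integral xi = fine \o (fun w =>
    \int[mu]_(t in `[0%R, 1%R]) F^\+ (t, w)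
    - \int[mu]_(t in `[0%R, 1%R]) F^\- (t, w))%E.
  apply/funext => w /=; rewrite /path_integral /Rintegral; congr fine.
  transitivity (\int[mu]_(t in `[0%R, 1%R]) F (t, w))%E; last first.
    by rewrite integralE; congr (_ - _)%E; apply: eq_integral => t _;
      rewrite ?funeposE ?funenegE.
  apply: eq_integral => t /set_mem/=; rewrite in_itv/= => t01.
  by rewrite /F/= /clamped clampE.
apply: measurableT_comp; first exact: fine_measurable.
by apply: emeasurable_funB; apply: measurable_integral_itv => //;
  [exact: measurable_funepos|exact: measurable_funeneg].
Qed.

(** [theta] and [eta] are families of times with parameter [r], the first component; [r] will bound
    the distance between them. *)
Definition deviation (xi : process T R) (theta eta : R * T -> R) (a b : R)
    (w : T) : \bar R :=
  (\int[mu]_(r in `[a, b])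
     `|clamped xi (theta (r, w)) w - clamped xi (eta (r, w)) w|%:E)%E.

Lemma deviation_ge0 xi theta eta a b w : (0 <= deviation xi theta eta a b w)%E.
Proof. by apply: integral_ge0 => r _; rewrite lee_fin. Qed.

Lemma measurable_clamped_dist xi (theta eta : R * T -> R) :
  measurable_fun setT theta -> measurable_fun setT eta ->
  measurable_fun setT (fun p : R * T =>
    `|clamped xi (theta p) p.2 - clamped xi (eta p) p.2|%:E).
Proof.
move=> mtheta meta; apply/measurable_EFinP; apply: measurableT_comp => //.
by apply: measurable_funB; exact: measurable_clamped_comp.
Qed.

Lemma measurable_deviation xi (theta eta : R * T -> R) a b :
  measurable_fun setT theta -> measurable_fun setT eta ->
  measurable_fun setT (deviation xi theta eta a b).
Proof.
move=> mtheta meta.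
apply: (measurable_integral_itv a b (measurable_clamped_dist xi mtheta meta)).
by move=> p; rewrite lee_fin.
Qed.

Context (omega : R -> R) (homega : concave_modulus omega).
Context (xi : process T R) (xi_class : modulus_class P omega xi).

(** Clamping turns [g] and [h] into random times at essential distance at most [b], to which the
    definition of the class applies. *)
Lemma modulus_class_le (g h : T -> R) (b : R) :
  measurable_fun setT g -> measurable_fun setT h -> 0 <= b ->
  {ae P, forall w, `|g w - h w| <= b} ->
  (\int[P]_w `|clamped xi (g w) w - clamped xi (h w) w|%:E <= (omega b)%:E)%E.
Proof.
move=> mg mh b0 ghb.
have bounded w : `|clamp_time mg w - clamp_time mh w| <= 1.
  rewrite ler_norml; have := random_timeP (clamp_time mg) w.
  by have := random_timeP (clamp_time mh) w; lra.
have := xi_class (clamp_time mg) (clamp_time mh).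
rewrite unlock => /le_trans; apply.
rewrite lee_fin; apply: (modulus_nondecreasing homega).
  exact: norm_infty_ge0 bounded.
apply: (norm_infty_le bounded); apply: filterS ghb => w.
exact/le_trans/clamp_dist.
Qed.

(** Tonelli moves the expectation inside; for each fixed [r] it is then at most [omega r]. The
    exceptional null set may depend on [r]. *)
Lemma expected_deviation_le (theta eta : R * T -> R) (a b : R) :
  measurable_fun setT theta -> measurable_fun setT eta -> 0 <= a ->
  (forall r, r \in `[a, b] ->
     {ae P, forall w, `|theta (r, w) - eta (r, w)| <= r}) ->
  (\int[P]_w deviation xi theta eta a b w
    <= \int[mu]_(r in `[a, b]) (omega r)%:E)%E.
Proof.
move=> mtheta meta a0 le_r.
pose F (p : R * T) := `|clamped xi (theta p) p.2 - clamped xi (eta p) p.2|%:E.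
have mF : measurable_fun setT F by exact: measurable_clamped_dist.
have F0 p : (0 <= F p)%E by rewrite lee_fin.
rewrite (fubini_tonelli_itv P a b mF F0).
have ab0 r : r \in `[a, b] -> 0 <= r.
  by rewrite in_itv/= => /andP[ar _]; exact: le_trans ar.
apply: ge0_le_integral => //=.
- by move=> r _; exact: integral_ge0.
- apply: measurable_funS (measurable_fun_fubini_tonelli_F _ mF F0) => //.
- by apply: measurable_modulusS => // r /ab0 /=; rewrite in_itv/= andbT.
move=> r rab; apply: modulus_class_le.
- exact: measurableT_comp mtheta _.
- exact: measurableT_comp meta _.
- exact: ab0.
- exact: le_r.
Qed.

End expected_error.

(** * Rearranging the end cells *)

Section end_cells.
Set Implicit Arguments.
Unset Strict Implicit.
Context (R : realType).
Local Notation mu := (@lebesgue_measure R).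
Variables (f : R -> R) (mf : measurable_fun setT f).

(* [x] and [1 - y] are the lengths of the two end cells. On ]x, b] the point
   y + (a - x + r) lies at distance a - x + r <= r from its node y. *)
Lemma end_cells_rearrangement (x y a b : R) :
  0 <= a -> a <= x -> x <= b -> y = 1 - (a + b - x) ->
  (left_deviation f x x + right_deviation f y (1 - y) =
   left_deviation f x a + right_deviation f y a +
   \int[mu]_(r in `[a, b])
     `|f (if (r <= x)%R then x - r else y + (a - x + r))
       - f (if (r <= x)%R then x else y)|%:E)%E.
Proof.
move=> a0 ax xb y1.
pose L r := `|f (x - r) - f x|%:E; pose Rt r := `|f (y + r) - f y|%:E.
pose G r := `|f (if (r <= x)%R then x - r else y + (a - x + r))
       - f (if (r <= x)%R then x else y)|%:E.
have mL : measurable_fun setT L.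
  apply/measurable_EFinP/measurableT_comp => //; apply: measurable_funB => //.
  by apply: measurableT_comp => //; exact: measurable_funB.
have mRt : measurable_fun setT Rt.
  apply/measurable_EFinP/measurableT_comp => //; apply: measurable_funB => //.
  by apply: measurableT_comp => //; exact: measurable_funD.
have mG : measurable_fun setT G.
  have mx : measurable_fun [set: R] (fun r => r <= x).
    exact: measurable_fun_ler.
  apply/measurable_EFinP/measurableT_comp => //; apply: measurable_funB => //;
    apply: measurableT_comp => //; apply: measurable_fun_ifT => //.
  - exact: measurable_funB.
  - by apply: measurable_funD => //; exact: measurable_funD.
have splitL : (left_deviation f x x =
    left_deviation f x a + \int[mu]_(r in `[a, x]) L r)%E.
  by apply: ge0_integral_itvU => //; apply: measurable_funTS; exact: mL.
have splitR : (right_deviation f y (1 - y) =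
    right_deviation f y a + \int[mu]_(r in `[a, (1 - y)%R]) Rt r)%E.
  by apply: ge0_integral_itvU => //; [lra|apply: measurable_funTS; exact: mRt].
have splitG : (\int[mu]_(r in `[a, b]) G r =
    \int[mu]_(r in `[a, x]) G r + \int[mu]_(r in `[x, b]) G r)%E.
  apply: ge0_integral_itvU => //; first by apply: measurable_funTS; exact: mG.
  by move=> r _; rewrite lee_fin.
have GL : (\int[mu]_(r in `[a, x]) G r = \int[mu]_(r in `[a, x]) L r)%E.
  by apply: eq_integral => r; rewrite inE/= in_itv/= /G => /andP[_ ->].
(* The rest [[a, 1 - y]] of the right cell is [[x, b]] translated by [a - x]. The endpoint [r = x],
   where [G] takes its first branch, is removed before the integrands are compared. *)
have GR : (\int[mu]_(r in `[x, b]) G r =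
    \int[mu]_(r in `[a, (1 - y)%R]) Rt r)%E.
  have -> : a = a - x + x by rewrite subrK.
  have -> : 1 - y = a - x + b by lra.
  rewrite ge0_integral_itvD//; last by move=> r; rewrite lee_fin.
  rewrite -!integral_itv_obnd_cbnd.
  - apply: eq_integral => r; rewrite inE/= in_itv/= /G => /andP[xr _].
    by rewrite leNgt xr /= /Rt; do 4 f_equal; lra.
  - apply: measurable_funTS; apply: measurableT_comp => //.
    exact: measurable_funD.
  - exact: measurable_funTS.
by rewrite splitL splitR -/G splitG GL GR addeACA.
Qed.

End end_cells.

(** Summation by cells turned into summation by gaps: each coefficient is the length of the cell
    around its node, and each inner gap gives half its length to both of its ends. *)
Lemma sum_optimal_coef d (T : measurableType d) (R : realType)
    (n : nat) (t : nat -> R) (tau : random_time T R) (v : nat -> R) (w : T) :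
  (0 < n)%N -> t 1%N = 0 ->
  \sum_(k < n) optimal_coef n t tau k.+1 w * v k.+1 =
  tau w * v 1%N + \sum_(1 <= k < n) (t k.+1 - t k) / 2 * (v k + v k.+1)
  + (1 - (tau w + t n)) * v n.
Proof.
case: n => // n _ t1.
(* Lengths of the parts of a cell on either side of its node; index [k] refers to node [k.+1]. *)
pose left k := if k == 0%N then tau w else (t k.+1 - t k) / 2.
pose right k := if k == n then 1 - (tau w + t n.+1) else (t k.+2 - t k.+1) / 2.
transitivity (\sum_(k < n.+1) (left k * v k.+1 + right k * v k.+1)).
  apply: eq_bigr => k _; rewrite -mulrDl; congr (_ * _).
  rewrite /optimal_coef /left /right !eqSS.
  (* After the shift [n = 0] means a single node, whose two parts add up to the coefficient 1. *)
  have [n0|n_neq0] := eqVneq n 0%N.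
    have k0 : k = 0%N :> nat by case: k => -[|k] //=; rewrite n0.
    by rewrite k0 n0 eqxx/= t1 addr0 subrKC.
  have [->|k_neq0] := eqVneq (k : nat) 0%N.
    by rewrite eq_sym (negbTE n_neq0)/=.
  have [->|k_neqn] := eqVneq (k : nat) n => /=; last by field.
  by transitivity (1 - tau w - (t n.+1 + t n) / 2); [|field].
rewrite big_split/= big_ord_recl [X in _ + X]big_ord_recr/=.
rewrite /left /right !eqxx/=.
rewrite addrA; congr (_ + _); rewrite -addrA; congr (_ + _).
rewrite big_add1 /= big_mkord -big_split/=; apply: eq_bigr => k _.
by rewrite ltn_eqF//= /bump/= add1n; ring.
Qed.

(** * Distance to the nodes *)

Section node_distance.
Set Implicit Arguments.
Unset Strict Implicit.
Context (R : realType).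
Local Notation mu := (@lebesgue_measure R).

(* The default value 1 is harmless: distances within [0, 1] never exceed it. *)
Definition node_distance (n : nat) (x : 'I_n -> R) (s : R) : R :=
  \big[Num.min/1]_(k < n) `|s - x k|.

Lemma node_distance_ge n (x : 'I_n -> R) s c :
  c <= 1 -> (forall k, c <= `|s - x k|) -> c <= node_distance x s.
Proof. by move=> c1 cx; apply/bigmin_geP; split. Qed.

Lemma node_distance_ge0 n (x : 'I_n -> R) s : 0 <= node_distance x s.
Proof. exact: node_distance_ge. Qed.

Lemma node_distance_le1 n (x : 'I_n -> R) s : node_distance x s <= 1.
Proof. exact: bigmin_le_id. Qed.

Lemma node_distance_le n (x : 'I_n -> R) s k : node_distance x s <= `|s - x k|.
Proof. exact: bigmin_le_cond. Qed.

(** A minimum of 1-Lipschitz functions and a constant is 1-Lipschitz. *)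
Lemma node_distance_lipschitz n (x : 'I_n -> R) s r :
  `|node_distance x s - node_distance x r| <= `|s - r|.
Proof.
have half u v : node_distance x u - `|u - v| <= node_distance x v.
  apply: node_distance_ge => [|k].
    by rewrite lerBlDr (le_trans (node_distance_le1 _ _))// lerDl.
  rewrite lerBlDl (le_trans (node_distance_le _ _ k))//.
  by rewrite (le_trans _ (ler_normD _ _))// addrA subrK.
have := half r s; have := half s r; rewrite distrC => ? ?.
by rewrite ler_norml; lra.
Qed.

Lemma measurable_node_distance d (T : measurableType d) n
    (x : 'I_n -> T -> R) (s : T -> R) :
  (forall k, measurable_fun setT (x k)) -> measurable_fun setT s ->
  measurable_fun setT (fun p => node_distance (x ^~ p) (s p)).
Proof.
move=> mx ms; rewrite /node_distance.
elim: (index_enum _) => [|k ks IH].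
  by under eq_fun do rewrite big_nil; exact: measurable_cst.
under eq_fun do rewrite big_cons; apply: measurable_minr => //.
by apply: measurableT_comp => //; exact: measurable_funB.
Qed.

Variables (omega : R -> R) (homega : concave_modulus omega).
Local Notation I := (modulus_primitive omega).
Variables (g : R -> R) (mg : measurable_fun setT g) (g0 : forall s, 0 <= g s).

Let mgE : measurable_fun setT (EFin \o g).
Proof. exact/measurable_EFinP. Qed.

Let integral_g (a b : R) : \bar R := (\int[mu]_(s in `[a, b]) (g s)%:E)%E.

Lemma modulus_primitive_le_right (x l : R) :
  (forall r, 0 <= r <= l -> omega r <= g (x + r)) ->
  ((I l)%:E <= integral_g x (x + l)%R)%E.
Proof.
move=> og; rewrite /integral_g -[X in `[X, _]](addr0 x).
rewrite (ge0_integral_itvD (f := EFin \o g))//.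
rewrite modulus_primitiveE//; apply: ge0_le_integral => //.
- by move=> r /=; rewrite in_itv/= => /andP[r0 _]; rewrite lee_fin modulus_ge0.
- by apply: measurable_modulusS => //; apply: subset_itvl; rewrite bnd_simp.
- apply: measurable_funTS; apply: measurableT_comp => //.
  exact: measurable_funD.
Qed.

Lemma modulus_primitive_le_left (x l : R) :
  (forall r, 0 <= r <= l -> omega r <= g (x - r)) ->
  ((I l)%:E <= integral_g (x - l)%R x)%E.
Proof.
move=> og; rewrite /integral_g -[X in `[_, X]](subr0 x).
rewrite (ge0_integral_itvB (f := EFin \o g))//.
rewrite modulus_primitiveE//; apply: ge0_le_integral => //.
- by move=> r /=; rewrite in_itv/= => /andP[r0 _]; rewrite lee_fin modulus_ge0.
- by apply: measurable_modulusS => //; apply: subset_itvl; rewrite bnd_simp.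
- apply: measurable_funTS; apply: measurableT_comp => //.
  exact: measurable_funB.
Qed.

Lemma integral_gU a b c : a <= b -> b <= c ->
  integral_g a c = (integral_g a b + integral_g b c)%E.
Proof.
move=> ab bc; apply: ge0_integral_itvU => //.
  exact: measurable_funTS.
by move=> s _; rewrite lee_fin.
Qed.

Variables (n : nat) (x : nat -> R).
Hypothesis x_mono : forall j k,
  (1 <= j)%N -> (j <= k)%N -> (k <= n)%N -> x j <= x k.
Hypothesis omega_le_g : forall s c, 0 <= c <= 1 ->
  (forall k, (1 <= k <= n)%N -> c <= `|s - x k|) -> omega c <= g s.
Let h k := (x k.+1 - x k) / 2.

Hypotheses (n_gt0 : (0 < n)%N) (x1_ge0 : 0 <= x 1%N) (xn_le1 : x n <= 1).

Let x_itv k : (1 <= k <= n)%N -> 0 <= x k <= 1.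
Proof.
move=> /andP[k1 kn]; rewrite (le_trans x1_ge0) ?x_mono//=.
by rewrite (le_trans _ xn_le1)// x_mono.
Qed.

(** The counterpart from below of the midpoint cut: a point of a half-cell at distance [r] from its
    own node is no closer to any other, so [g] is at least [omega r] there. *)
Lemma modulus_primitive_le_nodes m : (1 <= m <= n)%N ->
  ((\sum_(1 <= k < m) (I (h k) + I (h k)))%R%:E
    <= integral_g (x 1%N) (x m))%E.
Proof.
elim: m => [//|[_ _|m IHm /andP[_ mn]]].
  by rewrite big_geq// integral_ge0// => s _; rewrite lee_fin.
have mitv : (1 <= m.+1 <= n)%N by exact: ltnW.
have := x_itv mitv; have := x_itv (k := m.+2); rewrite mn => /(_ isT) x2 x1.
have xm : x m.+1 <= x m.+2 by exact: x_mono.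
rewrite big_nat_recr//= (@integral_gU _ (x m.+1))//; last exact: x_mono.
have mid : x m.+1 + h m.+1 = x m.+2 - h m.+1 by rewrite /h; field.
rewrite EFinD leeD ?IHm//.
rewrite (@integral_gU _ (x m.+1 + h m.+1)); [|rewrite /h; lra|rewrite /h; lra].
(* Every node lies either to the left of this gap or to its right, its two ends included. *)
have near_node r k : 0 <= r <= h m.+1 -> (1 <= k <= n)%N ->
    r <= `|x m.+1 + r - x k| /\ r <= `|x m.+2 - r - x k|.
  rewrite /h => r0 /andP[k1 kn]; have [km|mk] := leqP k m.+1.
    have xk : x k <= x m.+1 by apply: x_mono => //; exact: ltnW.
    by split; rewrite ler_normr; apply/orP; left; lra.
  have xk : x m.+2 <= x k by exact: x_mono.
  by split; rewrite ler_normr; apply/orP; right; lra.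
rewrite EFinD leeD//.
  apply: modulus_primitive_le_right => r rh.
  apply: omega_le_g => [|k /near_node].
    by move: rh; rewrite /h; lra.
  by case/(_ r rh).
rewrite mid; apply: modulus_primitive_le_left => r rh.
apply: omega_le_g => [|k /near_node]; first by move: rh; rewrite /h; lra.
by case/(_ r rh).
Qed.

Lemma modulus_primitive_le_path :
  ((I (x 1%N) + \sum_(1 <= k < n) (I (h k) + I (h k)) + I (1 - x n))%R%:E
    <= \int[mu]_(s in `[0%R, 1%R]) (g s)%:E)%E.
Proof.
have /andP[_ x1_le1] : 0 <= x 1%N <= 1 by apply: x_itv; rewrite n_gt0.
have /andP[xn_ge0 _] : 0 <= x n <= 1 by apply: x_itv; rewrite n_gt0/=.
rewrite -/(integral_g 0 1) (integral_gU xn_ge0)//.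
rewrite (integral_gU x1_ge0) ?x_mono//.
rewrite !EFinD !leeD//; last 2 first.
- by apply: modulus_primitive_le_nodes; rewrite n_gt0/=.
- rewrite -[X in integral_g _ X](subrKC (x n)).
  apply: modulus_primitive_le_right => r rn.
  apply: omega_le_g => [|k /andP[k1 kn]].
    by lra.
  by rewrite ler_normr; have := x_mono k1 kn (leqnn n); lra.
rewrite -[X in integral_g X](subrr (x 1%N)).
apply: modulus_primitive_le_left => r r1.
apply: omega_le_g => [|k /andP[k1 kn]].
  by lra.
by rewrite ler_normr; have := x_mono (leqnn 1) k1 kn; lra.
Qed.

End node_distance.

(** * The two bounds *)

Section shifted_times.
Set Implicit Arguments.
Unset Strict Implicit.
Context d (T : measurableType d) (R : realType) (P : probability T R).
Local Notation mu := (@lebesgue_measure R).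
Context (omega : R -> R) (homega : concave_modulus omega).
Context (n : nat) (hn : (0 < n)%N) (tau : random_time T R) (t : nat -> R).
Hypothesis ht1 : t 1%N = 0.
Hypothesis ht : forall k : nat, (1 <= k)%N -> (k < n)%N -> t k < t k.+1.
Hypothesis htau : {ae P, forall w, tau w + t n <= 1}.
Context (tauk : 'I_n -> random_time T R).
Hypothesis htauk : forall k : 'I_n, {ae P, forall w, tauk k w = tau w + t k.+1}.
Local Notation I := (modulus_primitive omega).
Local Notation tstar := (norm_infty P (fun w => tau w - (1 - t n) / 2)).

(** A probability measure is nonzero, so its almost-everywhere filter is proper. One good sample
    point suffices for a deterministic fact such as [t n <= 1]. *)
Lemma ae_witness (Q : T -> Prop) : {ae P, forall w, Q w} -> exists w, Q w.
Proof.
move=> aeQ; have PT : (0 < P [set: T])%E.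
  by rewrite probability_setT lte_fin ltr01.
have ? := ae_properfilter_algebraOfSetsType PT.
exact: (filter_ex aeQ).
Qed.

Lemma times_mono j k : (1 <= j)%N -> (j <= k)%N -> (k <= n)%N -> t j <= t k.
Proof.
move=> j1; elim: k => [|k IHk]; first by rewrite leqn0 => /eqP ->.
rewrite leq_eqVlt => /predU1P[->//|]; rewrite ltnS => jk kn.
by rewrite (le_trans (IHk jk (ltnW kn)))// ltW// ht// (leq_trans j1).
Qed.

Lemma last_time_itv : 0 <= t n <= 1.
Proof.
rewrite -[X in X <= _]ht1 times_mono//=.
have [w tauw] := ae_witness htau.
by have := random_timeP tau w; lra.
Qed.

Lemma offset_bounded w : `|tau w - (1 - t n) / 2| <= 1.
Proof.
by rewrite ler_norml; have := random_timeP tau w; have := last_time_itv; lra.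
Qed.

(** Almost surely [tau] lies in [[0, 1 - t n]], whose midpoint is [(1 - t n) / 2]. Hence [I] is only
    evaluated at nonnegative arguments. *)
Lemma offset_norm_itv : 0 <= tstar <= (1 - t n) / 2.
Proof.
rewrite (norm_infty_ge0 P offset_bounded)/=.
apply: (norm_infty_le offset_bounded).
apply: filterS htau => w tauw.
by rewrite ler_norml; have := random_timeP tau w; lra.
Qed.

Lemma ae_regular : {ae P, forall w, [/\ 0 <= tau w, tau w + t n <= 1,
  `|tau w - (1 - t n) / 2| <= tstar &
  forall k : 'I_n, tauk k w = tau w + t k.+1]}.
Proof.
have htauk_all : {ae P, forall w, forall k, tauk k w = tau w + t k.+1}.
  exact: filter_forall.
have tau_tstar := ae_le_norm_infty P offset_bounded.
apply: filterS (filterI htau (filterI tau_tstar htauk_all)) => w [? [? ?]].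
by split => //; case/andP: (random_timeP tau w).
Qed.

(** * Upper bound: the error of the linear method *)

Lemma le_integralD (f g : T -> \bar R) (A B : \bar R) :
  measurable_fun setT f -> measurable_fun setT g ->
  (forall w, (0 <= f w)%E) -> (forall w, (0 <= g w)%E) ->
  (\int[P]_w f w <= A)%E -> (\int[P]_w g w <= B)%E ->
  (\int[P]_w (f w + g w) <= A + B)%E.
Proof. by move=> mf mg f0 g0 fA gB; rewrite ge0_integralD// leeD. Qed.

(** Almost surely both end cells have lengths in [[a1, b1]], and these two lengths add up to
    [a1 + b1]. *)
Let a1 := (1 - t n) / 2 - tstar.
Let b1 := (1 - t n) / 2 + tstar.
Let value := 2 * (\sum_(1 <= k < n) I ((t k.+1 - t k) / 2)) + I a1 + I b1.

Let shift c (p : R * T) := tau p.2 + c.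
Let before c (p : R * T) := tau p.2 + c - p.1.
Let after c (p : R * T) := tau p.2 + c + p.1.
Let end_node (p : R * T) := if p.1 <= tau p.2 then tau p.2 else tau p.2 + t n.
Let end_time (p : R * T) := if p.1 <= tau p.2 then tau p.2 - p.1
  else tau p.2 + t n + (a1 - tau p.2 + p.1).

Let mtau : measurable_fun setT (fun p : R * T => tau p.2).
Proof. exact: measurableT_comp. Qed.

Let mshift c : measurable_fun setT (shift c).
Proof. exact: measurable_funD. Qed.

Let mbefore c : measurable_fun setT (before c).
Proof. by apply: measurable_funB => //; exact: mshift. Qed.

Let mafter c : measurable_fun setT (after c).
Proof. by apply: measurable_funD => //; exact: mshift. Qed.

Let mcond : measurable_fun setT (fun p : R * T => p.1 <= tau p.2).
Proof. exact: measurable_fun_ler. Qed.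

Let mend_node : measurable_fun setT end_node.
Proof. by apply: measurable_fun_ifT => //; exact: measurable_funD. Qed.

Let mend_time : measurable_fun setT end_time.
Proof.
apply: measurable_fun_ifT => //; first exact: measurable_funB.
apply: measurable_funD; first exact: measurable_funD.
by apply: measurable_funD => //; exact: measurable_funB.
Qed.

Let cell xi k w :=
  let h := ((t k.+1 - t k) / 2)%R in
  (deviation xi (after (t k)) (shift (t k)) 0 h w
  + deviation xi (before (t k.+1)) (shift (t k.+1)) 0 h w)%E.

Let ends xi w := (deviation xi (before 0) (shift 0) 0 a1 w
  + deviation xi (after (t n)) (shift (t n)) 0 a1 w)%E.

Let error_bound xi w := (ends xi w + deviation xi end_time end_node a1 b1 w
  + \sum_(1 <= k < n) cell xi k w)%E.

Let linear_recovery xi :=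
  recovery_value tauk
    (linear_method (fun k : 'I_n => optimal_coef n t tau k.+1)) xi.

(** At a fixed regular [w] this is the deterministic quadrature bound with nodes [tau w + t k], its
    two end terms rearranged. *)
Lemma path_error_le xi w :
  [/\ 0 <= tau w, tau w + t n <= 1, `|tau w - (1 - t n) / 2| <= tstar &
    forall k : 'I_n, tauk k w = tau w + t k.+1] ->
  (`|path_integral xi w - linear_recovery xi w|%:E <= error_bound xi w)%E.
Proof.
move=> [tau0 taun tau_tstar tauE].
pose f s := clamped xi s w; pose x k := tau w + t k.
have mf : measurable_fun setT f.
  apply: (measurableT_comp (measurable_clamped xi) (g := pair^~ w)).
  exact: measurable_pair2.
have x1 : x 1%N = tau w by rewrite /x ht1 addr0.
have recE : linear_recovery xi w =
    \sum_(k < n) optimal_coef n t tau k.+1 w * f (x k.+1).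
  rewrite /linear_recovery /recovery_value /linear_method mfun_sum.
  apply: eq_bigr => k _; rewrite mfunM /= tnth_mktuple; congr (_ * _).
  rewrite /f /x /clamped -tauE clampE//; exact: random_timeP.
have pathE : path_integral xi w = \int[mu]_(s in `[0, 1]) f s.
  apply: eq_Rintegral => s /set_mem/=; rewrite in_itv/= => s01.
  by rewrite /f /clamped clampE.
have x_mono k : (1 <= k < n)%N -> x k <= x k.+1.
  by move=> /andP[k1 kn]; rewrite lerD2l ltW// ht.
have := nearest_point_quadrature_bound mf x_mono hn.
rewrite x1 => /(_ tau0 taun).
have hE k : (x k.+1 - x k) / 2 = (t k.+1 - t k) / 2 by rewrite /x; field.
rewrite pathE recE (sum_optimal_coef _ (fun k => f (x k)) _ hn ht1).
under eq_bigr do rewrite hE.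
rewrite x1 => /le_trans; apply.
have /andP[tstar0 tstar_le] := offset_norm_itv.
move: tau_tstar; rewrite ler_norml => tau_tstar.
rewrite addeAC (@end_cells_rearrangement _ f mf (tau w) (x n) a1 b1);
  last 4 first.
- by rewrite /a1; lra.
- by rewrite /a1; lra.
- by rewrite /b1; lra.
- by rewrite /a1 /b1 /x; lra.
rewrite /error_bound /ends (_ : deviation _ (before 0) _ _ _ _ =
    left_deviation f (tau w) a1).
  by under eq_bigr do rewrite hE; exact: lexx.
by apply: eq_integral => r _; rewrite /before /shift/= addr0.
Qed.

Lemma expected_error_le xi : modulus_class P omega xi ->
  (\int[P]_w `|path_integral xi w - linear_recovery xi w|%:E <= value%:E)%E.
Proof.
move=> xi_class.
have mcell k : measurable_fun setT (cell xi k).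
  by apply: emeasurable_funD; exact: measurable_deviation.
have cell0 k w : (0 <= cell xi k w)%E by apply: adde_ge0; exact: deviation_ge0.
have mends : measurable_fun setT (ends xi).
  by apply: emeasurable_funD; exact: measurable_deviation.
have mends3 : measurable_fun setT
    (fun w => ends xi w + deviation xi end_time end_node a1 b1 w)%E.
  by apply: emeasurable_funD => //; exact: measurable_deviation.
have mcells : measurable_fun setT (fun w => \sum_(1 <= k < n) cell xi k w)%E.
  exact: emeasurable_sum.
have /andP[tstar0 tstar_le] := offset_norm_itv.
have a10 : 0 <= a1 by rewrite subr_ge0.
have ab1 : a1 <= b1 by rewrite /a1 /b1; lra.
have half_cell (m : R) (theta : R * T -> R) (c : R) :
    0 <= c -> measurable_fun setT theta ->
    (forall r, r \in `[0, c] ->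
      forall w, `|theta (r, w) - shift m (r, w)| <= r) ->
    (\int[P]_w deviation xi theta (shift m) 0 c w <= (I c)%:E)%E.
  move=> c0 mtheta h; rewrite modulus_primitiveE//.
  apply: expected_deviation_le => // r rc; apply: nearW => w; exact: h.
have le_after m c : 0 <= c ->
    (\int[P]_w deviation xi (after m) (shift m) 0 c w <= (I c)%:E)%E.
  move=> c0; apply: half_cell => // r; rewrite in_itv/= => /andP[r0 _] w.
  by rewrite /after /shift/= addrC addKr ger0_norm.
have le_before m c : 0 <= c ->
    (\int[P]_w deviation xi (before m) (shift m) 0 c w <= (I c)%:E)%E.
  move=> c0; apply: half_cell => // r; rewrite in_itv/= => /andP[r0 _] w.
  by rewrite /before /shift/= addrC addKr normrN ger0_norm.
have ends_ge0 w : (0 <= ends xi w)%E.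
  by apply: adde_ge0; exact: deviation_ge0.
have ends3_ge0 w : (0 <= ends xi w + deviation xi end_time end_node a1 b1 w)%E.
  by apply: adde_ge0 => //; exact: deviation_ge0.
apply: (@le_trans _ _ (\int[P]_w error_bound xi w)%E).
  apply: ae_ge0_le_integral => //.
  - apply/measurable_EFinP/measurableT_comp => //; apply: measurable_funB => //.
    exact: measurable_path_integral.
  - by move=> w _; apply: adde_ge0; [exact: ends3_ge0|exact: sume_ge0].
  - exact: emeasurable_funD.
  - by apply: filterS ae_regular => w reg _; exact: path_error_le.
(* [I b1] is split at [a1], to match the two fixed end pieces and the glued family. *)
have -> : value%:E = ((I a1)%:E + (I a1)%:E +
    \int[mu]_(r in `[a1, b1]) (omega r)%:E
    + \sum_(1 <= k < n) (I ((t k.+1 - t k) / 2) + I ((t k.+1 - t k) / 2))%:E)%E.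
  rewrite -[X in (X + _)%E]addeA -(modulus_primitiveB homega a10 ab1) sumEFin.
  by rewrite -!EFinD big_split/=; congr _%:E; rewrite /value; ring.
apply: le_integralD => //.
- by move=> w; exact: sume_ge0.
- apply: le_integralD => //.
  + exact: measurable_deviation.
  + by move=> w; exact: deviation_ge0.
  + apply: le_integralD.
    * exact: measurable_deviation.
    * exact: measurable_deviation.
    * by move=> w; exact: deviation_ge0.
    * by move=> w; exact: deviation_ge0.
    * exact: le_before.
    * exact: le_after.
  apply: expected_deviation_le => // r; rewrite in_itv/= => /andP[ar rb].
  apply: filterS ae_regular => w [tau0 taun + _].
  rewrite ler_norml => tau_tstar.
  (* On the second branch of the glued family the distance is [a1 - tau w + r], which is at most [r]
     by this inequality. *)
  have a1tau : a1 <= tau w by rewrite /a1; lra.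
  rewrite /end_time /end_node/= ler_norml.
  by case: ifPn; rewrite -?ltNge => ?; lra.
- rewrite ge0_integral_sum//.
  rewrite !big_seq; apply: lee_sum => k.
  rewrite mem_index_iota => /andP[k1 kn].
  have h0 : 0 <= (t k.+1 - t k) / 2 by rewrite divr_ge0// subr_ge0 ltW// ht.
  rewrite EFinD; apply: le_integralD.
  + exact: measurable_deviation.
  + exact: measurable_deviation.
  + by move=> w; exact: deviation_ge0.
  + by move=> w; exact: deviation_ge0.
  + exact: le_after.
  + exact: le_before.
Qed.

(** * Lower bound: opposite processes vanishing at the nodes *)

Lemma measurable_modulus_node_distance :
  measurable_fun setT
    (fun p : R * T => omega (node_distance (tauk ^~ p.2) p.1)).
Proof.
under eq_fun do rewrite -(max_idPr (node_distance_ge0 (tauk ^~ _) _)).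
apply: (measurableT_comp (measurable_modulus_max0 homega)).
apply: (@measurable_node_distance _ _ _ _
  (fun k (p : R * T) => tauk k p.2)) => // k.
exact: measurableT_comp.
Qed.

Lemma measurable_bump (c : R) (A : set T) : measurable A ->
  measurable_fun setT (fun p : R * T =>
    c * \1_A p.2 * omega (node_distance (tauk ^~ p.2) p.1)).
Proof.
move=> mA; apply: measurable_funM; last exact: measurable_modulus_node_distance.
by apply: measurable_funM => //; exact: measurableT_comp.
Qed.

Definition bump (c : R) (A : set T) (mA : measurable A) : process T R :=
  @Process _ T R (fun s w => c * \1_A w * omega (node_distance (tauk ^~ w) s))
    (measurable_funTS (measurable_bump c mA)).

Lemma bump_sample c A (mA : measurable A) k :
  sample (bump c mA) (tauk k) = 0.
Proof.
apply/mfuneqP => w; rewrite /sample/= /sample_fun /=.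
suff -> : node_distance (tauk ^~ w) (tauk k w) = 0.
  by rewrite modulus0// mulr0.
apply/eqP; rewrite eq_le node_distance_ge0 andbT.
by rewrite (le_trans (node_distance_le _ _ k))// subrr normr0.
Qed.

Lemma integral_scale_indic (c : R) (A : set T) : measurable A -> 0 <= c ->
  (\int[P]_w (c * \1_A w)%:E = (c * fine (P A))%:E)%E.
Proof.
move=> mA c0; under eq_integral do rewrite EFinM.
rewrite ge0_integralZl//; last exact/measurable_EFinP.
by rewrite integral_indic// setIT EFinM fineK// fin_num_measure.
Qed.

(** Almost surely an increment is at most [|c| * omega N] on [A] and zero elsewhere; in expectation
    the factor [P A] compensates for [|c|]. *)
Lemma bump_class c A (mA : measurable A) : `|c| * fine (P A) <= 1 ->
  modulus_class P omega (bump c mA).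
Proof.
move=> cA theta eta; rewrite unlock.
have bounded w : `|theta w - eta w| <= 1.
  rewrite ler_norml; have := random_timeP theta w.
  by have := random_timeP eta w; lra.
set N := norm_infty _ _.
have N0 : 0 <= N := norm_infty_ge0 P bounded.
apply: (@le_trans _ _ (\int[P]_w (`|c| * omega N * \1_A w)%:E)%E).
  apply: ae_ge0_le_integral => //.
  - by apply/measurable_EFinP/measurableT_comp => //; exact: measurable_funB.
  - by move=> w _; rewrite lee_fin !mulr_ge0// modulus_ge0.
  - by apply/measurable_EFinP; exact: measurable_funM.
  apply: filterS (ae_le_norm_infty P bounded) => w wN _.
  rewrite lee_fin /sample/= /sample_fun/= -mulrBr !normrM.
  rewrite (ger0_norm (_ : 0 <= \1_A w))//.
  rewrite mulrAC ler_wpM2r// ler_wpM2l//.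
  rewrite (le_trans (modulus_distB homega
    (node_distance_ge0 _ _) (node_distance_ge0 _ _)))//.
  apply: modulus_nondecreasing => //.
  by rewrite (le_trans (node_distance_lipschitz _ _ _)).
rewrite integral_scale_indic//; last by rewrite mulr_ge0// modulus_ge0.
by rewrite lee_fin mulrAC ler_piMl// modulus_ge0.
Qed.

Let path_mass w := \int[mu]_(s in `[0, 1]) omega (node_distance (tauk ^~ w) s).

Let mmodulus w :
  measurable_fun setT (fun s => omega (node_distance (tauk ^~ w) s)).
Proof.
apply: (measurableT_comp measurable_modulus_node_distance (g := pair^~ w)).
exact: measurable_pair2.
Qed.

Let integrable_modulus_node_distance w :
  mu.-integrable `[0, 1]
    (EFin \o (fun s => omega (node_distance (tauk ^~ w) s))).
Proof.
apply: le_integrable (integrable_cst_itv 0 1 (omega 1)) => //.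
  by apply/measurable_EFinP; apply: measurable_funTS; exact: mmodulus.
move=> s _; rewrite lee_fin.
rewrite !ger0_norm ?(modulus_ge0 homega) ?node_distance_ge0//.
apply: (modulus_nondecreasing homega); first exact: node_distance_ge0.
exact: node_distance_le1.
Qed.

Lemma path_integral_bump c A (mA : measurable A) w :
  path_integral (bump c mA) w = c * \1_A w * path_mass w.
Proof.
by rewrite /path_integral/= RintegralZl//;
  exact: integrable_modulus_node_distance.
Qed.

Lemma path_mass_ge0 w : 0 <= path_mass w.
Proof.
apply: Rintegral_ge0 => s _; apply: modulus_ge0 => //.
exact: node_distance_ge0.
Qed.

(** For [u >= 0] the shorter end can only gain by moving from [tstar] to [u]. The longer one loses
    at most [e * omega 1], since [b1 <= 1]. *)
Lemma modulus_primitive_ends_ge (u e : R) : 0 <= e ->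
  `|u| <= tstar -> tstar - e < `|u| ->
  I a1 + I b1 - e * omega 1 <= I ((1 - t n) / 2 + u) + I ((1 - t n) / 2 - u).
Proof.
move=> e0.
have /andP[tstar0 tstar_le] := offset_norm_itv.
have /andP[tn0 tn1] := last_time_itv.
(* The right-hand side is even in [u]. *)
wlog u0 : u / 0 <= u.
  move=> wl; have [/wl//|/ltW u0] := leP 0 u.
  move=> ule ugt; rewrite [X in _ <= X]addrC.
  by have := wl (- u); rewrite oppr_ge0 normrN opprK; exact.
rewrite ger0_norm// => u_le u_gt.
have a1_le : I a1 <= I ((1 - t n) / 2 - u).
  by apply: le_modulus_primitive => //; rewrite /a1; lra.
have b1_le : I b1 <=
    I ((1 - t n) / 2 + u) + (b1 - ((1 - t n) / 2 + u)) * omega b1.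
  by apply: modulus_primitive_le => //; rewrite /b1; lra.
have : (b1 - ((1 - t n) / 2 + u)) * omega b1 <= e * omega 1.
  apply: ler_pM.
  - by rewrite /b1; lra.
  - by apply: (modulus_ge0 homega); rewrite /b1; lra.
  - by rewrite /b1; lra.
  - by apply: (modulus_nondecreasing homega); rewrite /b1; lra.
by lra.
Qed.

Lemma path_mass_ge e w : 0 <= e ->
  [/\ 0 <= tau w, tau w + t n <= 1, `|tau w - (1 - t n) / 2| <= tstar &
    forall k : 'I_n, tauk k w = tau w + t k.+1] ->
  tstar - e < `|tau w - (1 - t n) / 2| ->
  value - e * omega 1 <= path_mass w.
Proof.
move=> e0 [tau0 taun tau_le tauE] tau_gt.
have := modulus_primitive_ends_ge e0 tau_le tau_gt.
(* With [u = tau w - (1 - t n) / 2] the two arguments become the lengths of the end cells. *)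
rewrite (_ : (1 - t n) / 2 + _ = tau w); last by field.
rewrite (_ : (1 - t n) / 2 - _ = 1 - (tau w + t n)); last by field.
move=> ends_ge.
pose x k := tau w + t k.
have x1 : x 1%N = tau w by rewrite /x ht1 addr0.
have : ((I (x 1%N)
    + \sum_(1 <= k < n) (I ((x k.+1 - x k) / 2) + I ((x k.+1 - x k) / 2))
    + I (1 - x n))%R%:E <= (path_mass w)%:E)%E.
  rewrite /path_mass /Rintegral fineK; last first.
    by apply: integrable_fin_num => //; exact: integrable_modulus_node_distance.
  apply: modulus_primitive_le_path; rewrite ?x1//.
  - by move=> s; apply: modulus_ge0 => //; exact: node_distance_ge0.
  - by move=> j k j1 jk kn; rewrite lerD2l; exact: times_mono.
  - move=> s c /andP[c0 c1] cx; apply: modulus_nondecreasing => //.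
    by apply: node_distance_ge => // k; rewrite tauE cx//=.
rewrite lee_fin x1 => /(le_trans _); apply.
have hE k : (x k.+1 - x k) / 2 = (t k.+1 - t k) / 2 by rewrite /x; field.
under eq_bigr do rewrite hE.
rewrite big_split/= /value /x; lra.
Qed.

(** Two opposite processes with the same data force one output [eta], and
    [|p - eta| + |p + eta| >= 2 p] for the path integral [p]. Twice the error is thus at least twice
    the mean of [p]. *)
Lemma recovery_error_ge (phi : recovery_method T R n) (e : R) : 0 < e ->
  ((value - e * omega 1)%:E <= recovery_error P omega tauk phi)%E.
Proof.
move=> e0.
have mtau' : measurable_fun setT (fun w => tau w - (1 - t n) / 2).
  exact: measurable_funB.
pose A := [set w | (tstar - e < `|tau w - (1 - t n) / 2|)%R].
have PA0 : (0 < P A)%E := norm_infty_attained P mtau' offset_bounded e0.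
have mA : measurable A by exact: measurable_norm_gt.
pose q := fine (P A).
have q0 : 0 < q by rewrite fine_gt0// PA0/= ltey_eq fin_num_measure.
(* For large [e] the difference may be negative; truncation keeps the comparison between nonnegative
   integrands. *)
pose v := Num.max 0 (value - e * omega 1).
have v0 : 0 <= v by rewrite le_max lexx.
have v_ge : value - e * omega 1 <= v by rewrite le_max lexx orbT.
pose xi := bump q^-1 mA; pose xi' := bump (- q^-1) mA.
have xi_class : modulus_class P omega xi.
  by apply: bump_class; rewrite ger0_norm ?invr_ge0 ?(ltW q0)// mulVf// gt_eqF.
have xi'_class : modulus_class P omega xi'.
  apply: bump_class.
  by rewrite normrN ger0_norm ?invr_ge0 ?(ltW q0)// mulVf// gt_eqF.
pose eta := recovery_value tauk phi xi.
have eta' : recovery_value tauk phi xi' = eta.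
  congr phi; apply: eq_from_tnth => k; rewrite !tnth_mktuple.
  by rewrite !bump_sample.
have path' w : path_integral xi' w = - path_integral xi w.
  by rewrite !path_integral_bump !mulNr.
have err : (\int[P]_w `|path_integral xi w - eta w|%:E
    <= recovery_error P omega tauk phi)%E.
  by apply: ereal_sup_ubound; exists xi => //; rewrite unlock.
have err' : (\int[P]_w `|path_integral xi w + eta w|%:E
    <= recovery_error P omega tauk phi)%E.
  apply: ereal_sup_ubound; exists xi' => //; rewrite unlock eta'.
  by apply: eq_integral => w _; rewrite path' -opprD normrN.
have mpath := measurable_path_integral xi.
have two_v : ((v + v)%:E <= recovery_error P omega tauk phi
    + recovery_error P omega tauk phi)%E.
  apply: le_trans (leeD err err').
  rewrite -ge0_integralD//; last 2 first.
  - by apply/measurable_EFinP/measurableT_comp => //; exact: measurable_funB.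
  - by apply/measurable_EFinP/measurableT_comp => //; exact: measurable_funD.
  have -> : (v + v)%:E = (\int[P]_w ((v + v) / q * \1_A w)%:E)%E.
    rewrite integral_scale_indic// ?divfK ?gt_eqF//.
    by rewrite divr_ge0 ?addr_ge0// ltW.
  apply: ae_ge0_le_integral => //.
  - by move=> w _; rewrite lee_fin mulr_ge0// divr_ge0 ?addr_ge0// ltW.
  - by apply/measurable_EFinP; exact: measurable_funM.
  - by move=> w _; rewrite adde_ge0// lee_fin.
  - apply: emeasurable_funD; apply/measurable_EFinP/measurableT_comp => //.
      exact: measurable_funB.
    exact: measurable_funD.
  apply: filterS ae_regular => w reg _.
  rewrite -EFinD lee_fin.
  apply: (@le_trans _ _ (path_integral xi w + path_integral xi w)).
    (* Off [A] both sides vanish; on [A] the factor [q^-1] is common to both. *)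
    rewrite path_integral_bump indicE.
    case: (boolP (w \in A)) => [/set_mem wA|_].
      rewrite !mulr1 -mulrDr mulrC ler_wpM2l ?invr_ge0 ?(ltW q0)//.
      have := path_mass_ge (ltW e0) reg wA.
      have := path_mass_ge0 w.
      by rewrite /v => ? ?; rewrite lerD// ge_max; apply/andP; split.
    by rewrite !mulr0 mul0r addr0.
  have := ler_norm (path_integral xi w - eta w).
  have := ler_norm (path_integral xi w + eta w).
  by lra.
apply: (le_trans (y := v%:E)); first by rewrite lee_fin.
(* Halving [two_v] needs the finite case only: [+oo] is trivial and [-oo] contradicts [two_v]. *)
move: two_v; case: (recovery_error _ _ _ _) => [r| |].
- by rewrite -EFinD !lee_fin; lra.
- by move=> _; exact: leey.
- by rewrite /= leeNy_eq.
Qed.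

Lemma recovery_error_linear_le :
  (recovery_error P omega tauk
     (linear_method (fun k : 'I_n => optimal_coef n t tau k.+1)) <= value%:E)%E.
Proof.
apply: ge_ereal_sup => _ [xi xi_class <-]; rewrite unlock.
exact: expected_error_le.
Qed.

Lemma value_le_recovery_error (phi : recovery_method T R n) :
  (value%:E <= recovery_error P omega tauk phi)%E.
Proof.
apply/lee_addgt0Pr => e e0.
(* The slack [e / (1 + omega 1)] costs at most [e]; the added 1 covers the case [omega 1 = 0]. *)
have w1 : 0 < 1 + omega 1 by rewrite ltr_wpDr// modulus_ge0.
have := recovery_error_ge phi (divr_gt0 e0 w1).
rewrite -leeBlDr// => /(le_trans _); apply.
rewrite -EFinB lee_fin lerD2l lerN2 mulrAC ler_pdivrMr// ler_pM2l//.
by rewrite lerDr.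
Qed.

End shifted_times.

Theorem theorem2 (R : realType) (d : measure_display) (T : measurableType d)
  (P : probability T R)
  (omega : R -> R) (homega : concave_modulus omega)
  (n : nat) (hn : (0 < n)%N)
  (tau : random_time T R)
  (t : nat -> R) (ht1 : t 1%N = 0)
  (ht : forall k : nat, (1 <= k)%N -> (k < n)%N -> t k < t k.+1)
  (htau : {ae P, forall w, tau w + t n <= 1})
  (* tau_k is any element of the class of [0, 1]-valued random times that is
     almost everywhere equal to tau + t_k (k is shifted since 'I_n starts
     at 0) *)
  (tauk : 'I_n -> random_time T R)
  (htauk : forall k : 'I_n, {ae P, forall w, tauk k w = tau w + t k.+1}) :
  let I := modulus_primitive omega in
  let tstar := norm_infty P (fun w => tau w - (1 - t n) / 2) in
  optimal_error P omega tauk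
    = (2 * (\sum_(1 <= k < n) I ((t k.+1 - t k) / 2))
       + I ((1 - t n) / 2 - tstar) + I ((1 - t n) / 2 + tstar))%:E
  /\ recovery_error P omega tauk
       (linear_method (fun k : 'I_n => optimal_coef n t tau k.+1))
     = optimal_error P omega tauk.
Proof.
move=> I tstar; set value := (X in X%:E).
set S := linear_method _.
have S_le : (recovery_error P omega tauk S <= value%:E)%E.
  exact: recovery_error_linear_le.
have ge_value phi : (value%:E <= recovery_error P omega tauk phi)%E.
  exact: value_le_recovery_error.
have opt : optimal_error P omega tauk = value%:E.
  apply/eqP; rewrite eq_le; apply/andP; split.
    apply: ge_ereal_inf.
    by exists (recovery_error P omega tauk S) => //; exists S.
  by apply: le_ereal_inf_tmp => _ [phi _ <-].
by split => //; rewrite opt; apply/eqP; rewrite eq_le S_le ge_value.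
Qed.
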